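(* Let $d\ge2$ and let $G$ be a finite vertex-transitive bipartite $d$-regular graph on $2n$ vertices. Write $$M(G,t)=\sum_{k=0}^n m_k(G)t^k=\prod_{k=1}^n(1+\gamma_k(G)t),\qquad \gamma_1(G)\le\gamma_2(G)\le\dots\le\gamma_n(G),$$ where $m_k(G)$ is the number of $k$-matchings of $G$. Then for every $k=1,\dots,n$ $$\gamma_k(G)\ge\frac{d^2}{4(d-1)}\,\frac{k^2}{n^2}.$$ Consequently, for the matching measure $\rho_G$ of $G$ we have $$\rho_G([-s,s])\le\frac{2\sqrt{d-1}}{d}\,s$$ for all real $s>0$.
   Context: Graphs are finite and simple. A graph is vertex-transitive if for all vertices $u,v$ there is an automorphism $\phi$ with $\phi(u)=v$. A $k$-matching is a set of $k$ pairwise vertex-disjoint edges; $m_0(G)=1$. The numbers $\gamma_k(G)$ are real and non-negative by the Heilmann--Lieb theorem. The matching polynomial of a graph $G$ on $2n$ vertices is $\mu(G,x)=\sum_{k=0}^n(-1)^km_k(G)x^{2n-2k}$; its zeros, with multiplicity, are $\pm\sqrt{\gamma_k(G)}$, $k=1,\dots,n$. The matching measure is the uniform probability measure on these zeros, $\rho_G=\frac1{v(G)}\sum_{z_i:\,\mu(G,z_i)=0}\delta(z_i)$, where $v(G)$ is the number of vertices, zeros are counted with multiplicity and $\delta(s)$ is the Dirac measure at $s$. *)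

(* Defs.v *)
From mathcomp Require Import all_boot all_order all_algebra all_fingroup.
From mathcomp Require Import all_classical all_reals all_analysis.
From mathcomp Require Import polyrcf.

Set Implicit Arguments.
Unset Strict Implicit.
Unset Printing Implicit Defensive.

Import Order.TTheory GRing.Theory Num.Theory.

Local Open Scope ring_scope.

Section Graphs.
Variables (V : finType) (E : rel V).

Definition simple_graph : Prop := symmetric E /\ irreflexive E.

Definition automorphism (phi : {perm V}) : Prop :=
  forall x y, E (phi x) (phi y) = E x y.

Definition vertex_transitive : Prop :=
  forall u v, exists phi : {perm V}, automorphism phi /\ phi u = v.

Definition bipartite : Prop :=
  exists A : {set V}, forall u v, E u v -> (u \in A) != (v \in A).

Definition regular (d : nat) : Prop := forall u, #|[set v | E u v]| = d.

Definition edges : {set {set V}} :=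
  [set [set p.1; p.2] | p : V * V & E p.1 p.2].

Definition is_matching (k : nat) (M : {set {set V}}) : bool :=
  [&& M \subset edges, finset.trivIset M & #|M| == k].

Definition num_matchings (k : nat) : nat :=
  #|[set M : {set {set V}} | is_matching k M]|.

End Graphs.

Section MatchingPolynomials.
Variables (R : realType) (V : finType) (E : rel V).

(* A matching has at most #|V|./2 edges, so the sums below miss no matching;
   #|V|./2 is n when #|V| = 2n. *)
Definition matching_gen_poly : {poly R} :=
  \sum_(0 <= k < #|V|./2.+1) (num_matchings E k)%:R *: 'X^k.

Definition matching_poly : {poly R} :=
  \sum_(0 <= k < #|V|./2.+1)
    ((-1) ^+ k * (num_matchings E k)%:R) *: 'X^(#|V| - k.*2).

(* gamma is indexed from 1 to n; its other values are irrelevant. *)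
Definition is_gamma (n : nat) (gamma : nat -> R) : Prop :=
  (forall i j : nat, (1 <= i)%N -> (i <= j)%N -> (j <= n)%N ->
     gamma i <= gamma j) /\
  matching_gen_poly = \prod_(1 <= k < n.+1) (1 + gamma k *: 'X).

(* By the Heilmann-Lieb theorem all complex zeros of the matching polynomial
   are real, so its real zeros are all of them. *)
Definition matching_zeros : seq R :=
  flatten [seq nseq (mup z matching_poly) z | z <- rootsR matching_poly].

Definition matching_measure : {measure set (measurableTypeR R) -> \bar R} :=
  mscale (#|V|%:R^-1)%:nng
    (msum (fun i => \d_(matching_zeros`_i : measurableTypeR R))
       (size matching_zeros)).

End MatchingPolynomials.

(* Main.v *)
(* Write [Z S] for the sum of [t ^+ #|M|] over the matchings [M] inside a vertex
   set [S]. If [G] is bipartite and [t > 0], an induction on [S] shows that "u is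
   uncovered" and "v is uncovered" are positively correlated for u, v on opposite
   sides, and negatively correlated for u, v on the same side. Applying this to the
   ends of an edge e in [G] minus e, with p_e the probability of e and f the
   probability that a given vertex is uncovered (the same for all vertices by
   transitivity), one gets t f^2 <= p_e (1 - p_e). As the p_e at a vertex sum to
   1 - f, this yields d^2 t f^2 <= d - 1. On the other hand
   n f = \sum_k (1 + gamma_k t)^-1, so if at least k of the gammas are at most c
   then k / (1 + c t) <= n f, and t = 1 / c gives both bounds. *)

Require Import Defs.
From mathcomp Require Import all_boot all_order all_algebra.
From mathcomp Require Import all_classical all_reals all_analysis.
From mathcomp Require Import perm zify ring lra polyrcf complex.

Import Order.TTheory GRing.Theory Num.Theory.

Local Open Scope ring_scope.

(** * Sums over matchings and the vertex recurrence *)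

Section MatchingSums.
Set Implicit Arguments.
Unset Strict Implicit.
Variables (V : finType) (E : rel V).
Hypothesis simpleE : simple_graph E.

(** Matchings of the subgraph induced on [S], kept as edge sets of the whole graph so that deleting
    a vertex only changes [S]. *)
Definition matching_in (S : {set V}) (M : {set {set V}}) : bool :=
  [&& M \subset edges E, finset.trivIset M & finset.cover M \subset S].

Lemma edgesP (e : {set V}) :
  reflect (exists u v, E u v /\ e = [set u; v]) (e \in edges E).
Proof.
apply: (iffP imsetP) => [[[u v]]|[u [v [Euv ->]]]].
  by rewrite inE /= => Euv ->; exists u, v.
by exists (u, v); rewrite ?inE.
Qed.

Lemma edge_neq u v : E u v -> u != v.
Proof. by case: simpleE => _ irrE; case: eqVneq => // ->; rewrite irrE. Qed.

Lemma card_edge e : e \in edges E -> #|e| = 2.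
Proof. by case/edgesP=> u [v [/edge_neq uv ->]]; rewrite cards2 uv. Qed.

Lemma edges_neq0 e : e \in edges E -> e != finset.set0.
Proof. by move/card_edge => e2; rewrite -card_gt0 e2. Qed.

Lemma card_cover_matching (M : {set {set V}}) :
  M \subset edges E -> finset.trivIset M -> #|finset.cover M| = (2 * #|M|)%N.
Proof.
move=> /fintype.subsetP sME /eqP <-.
rewrite (eq_bigr (fun=> 2%N)) ?sum_nat_const ?(mulnC 2)//.
by move=> e /sME /card_edge.
Qed.

Lemma edge_mem_matching v e (M : {set {set V}}) (S : {set V}) :
  matching_in S M -> e \in M -> v \in e ->
  exists2 w, [&& E v w, w \in S & w != v] & e = [set v; w].
Proof.
case: simpleE => symE irrE.
case/and3P => /fintype.subsetP sME _ /fintype.subsetP cMS eM ve.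
have := sME _ eM; case/edgesP=> x [y [Exy eE]].
have inS z : z \in e -> z \in S.
  by move=> ze; apply: cMS; apply/bigcupP; exists e.
have xS : x \in S by apply: inS; rewrite eE !inE eqxx.
have yS : y \in S by apply: inS; rewrite eE !inE eqxx orbT.
move: ve; rewrite eE !inE => /orP[] /eqP ->.
  by exists y => //; rewrite Exy yS eq_sym edge_neq.
by exists x; rewrite 1?finset.setUC // symE Exy xS edge_neq.
Qed.

Lemma matching_inD1 v (S : {set V}) (M : {set {set V}}) : v \in S ->
  matching_in (S :\ v) M = matching_in S M && (v \notin finset.cover M).
Proof. by move=> vS; rewrite /matching_in finset.subsetD1 !andbA. Qed.

Lemma matching_inU1 v w (S : {set V}) (M : {set {set V}}) :
  E v w -> v \in S -> w \in S ->
  [set v; w] \notin M ->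
  matching_in S ([set v; w] |: M) = matching_in (S :\ v :\ w) M.
Proof.
move=> Evw vS wS eM.
have vwE : [set v; w] \in edges E by apply/edgesP; exists v, w.
apply/and3P/and3P => [[sM tM cM]|[sM tM cM]].
  have sM' : M \subset edges E.
    by apply: fintype.subset_trans sM; apply: finset.subsetUr.
  split=> //; first by apply: trivIsetS tM; apply: finset.subsetUr.
  apply/fintype.subsetP => x /bigcupP[f fM xf].
  have fe : [disjoint [set v; w] & f].
    move/finset.trivIsetP: tM; apply; rewrite ?finset.setU11 ?finset.setU1r//.
    by apply: contraNneq eM => ->.
  have xS : x \in S.
    move/fintype.subsetP: cM; apply; apply/bigcupP; exists f => //.
    by rewrite finset.setU1r.
  move: fe; rewrite disjoint_sym => /disjointFr/(_ xf).
  by rewrite !inE xS andbT => /norP[-> ->].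
have disj : {in M, forall f : {set V}, [disjoint [set v; w] & f]}.
  move=> f fM; rewrite disjoint_sym finset.disjoints_subset.
  apply/fintype.subsetP => x xf; have : x \in S :\ v :\ w.
    by move/fintype.subsetP: cM; apply; apply/bigcupP; exists f.
  by rewrite !inE negb_or => /and3P[-> ->].
have M0 : finset.set0 \notin M.
  by apply/negP => /(fintype.subsetP sM)/edges_neq0; rewrite eqxx.
split; first by rewrite finset.subUset finset.sub1set vwE.
  by case: (trivIsetU1 disj tM M0).
rewrite /finset.cover finset.bigcup_setU finset.big_set1 !finset.subUset !finset.sub1set vS wS /=.
by apply: fintype.subset_trans cM _; rewrite finset.setDDl finset.subsetDl.
Qed.

Lemma matching_in_setT (M : {set {set V}}) :
  matching_in [set: V] M = (M \subset edges E) && finset.trivIset M.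
Proof. by rewrite /matching_in finset.subsetT andbT. Qed.

Lemma matching_in0 (S : {set V}) : matching_in S finset.set0.
Proof.
apply/and3P; rewrite finset.sub0set /finset.cover finset.big_set0 finset.sub0set.
by split=> //; apply/finset.trivIsetP => A B; rewrite inE.
Qed.

Variable K : comNzRingType.

(** The ring is arbitrary because [t] will be a real number, a complex number and the indeterminate
    ['X]. *)
Definition matching_sum (t : K) (S : {set V}) : K :=
  \sum_(M : {set {set V}} | matching_in S M) t ^+ #|M|.

(** Removing the edge is a bijection onto the matchings that avoid both its ends. *)
Lemma matching_sum_edge t v w (S : {set V}) : E v w -> v \in S -> w \in S ->
  \sum_(M : {set {set V}} | matching_in S M && ([set v; w] \in M)) t ^+ #|M|
    = t * matching_sum t (S :\ v :\ w).
Proof.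
move=> Evw vS wS.
rewrite (reindex_onto (fun M => [set v; w] |: M) (fun M => M :\ [set v; w]))/=;
  last by move=> M /andP[_ eM]; rewrite finset.setD1K.
rewrite /matching_sum mulr_sumr; apply: eq_big => [M|M].
  rewrite finset.setU11 andbT.
  (* If [M] already contains the edge, both conditions fail: adding and then removing the edge does
     not give back [M], and [M] covers [v], which lies outside [S :\ v :\ w]. *)
  have [eM|eM] := boolP ([set v; w] \in M).
    rewrite [X in _ && X](_ : _ = false) ?andbF; last first.
      by apply/eqP => /setP/(_ [set v; w]); rewrite !inE eqxx eM.
    apply/esym/negP => /and3P[_ _ /fintype.subsetP/(_ v)].
    rewrite !inE eqxx andbF => H; apply: notF; apply: H.
    by apply/bigcupP; exists [set v; w] => //; rewrite !inE eqxx.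
  by rewrite matching_inU1 // finset.setU1K // eqxx andbT.
case/andP => _ /eqP MU.
have eM : [set v; w] \notin M by rewrite -MU !inE eqxx.
by rewrite cardsU1 eM exprS.
Qed.

(** A matching either leaves [v] uncovered or pairs it with exactly one neighbour [w]. *)
Lemma matching_sum_rec t v (S : {set V}) : v \in S ->
  matching_sum t S = matching_sum t (S :\ v) +
    t * \sum_(w | E v w && (w \in S)) matching_sum t (S :\ v :\ w).
Proof.
move=> vS.
rewrite {1}/matching_sum (bigID (fun M : {set {set V}} => v \notin finset.cover M)) /=.
congr (_ + _).
  by apply: eq_bigl => M; rewrite matching_inD1.
rewrite mulr_sumr.
under [RHS]eq_bigr => w /andP[Evw wS] do rewrite -matching_sum_edge //.
rewrite (exchange_big_dep (fun M => matching_in S M && (v \in finset.cover M))) /=.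
  rewrite (eq_bigl (fun M => matching_in S M && (v \in finset.cover M)));
    last by move=> M; rewrite negbK.
  apply: eq_bigr => M /andP[mM /bigcupP[e eM ve]].
  have [w /and3P[Evw wS wv] eE] := edge_mem_matching mM eM ve.
  rewrite (big_pred1 w) // => x /=.
  apply/andP/eqP => [[/andP[Evx xS] /andP[_ xM]]|->]; last first.
    by rewrite Evw wS mM -eE eM.
  apply/eqP; apply: contraT => xw.
  case/and3P: mM => _ /finset.trivIsetP/(_ _ _ eM xM) disj _.
  have : e != [set v; x].
    rewrite eE; apply/eqP => /setP/(_ w); rewrite !inE eqxx orbT.
    by rewrite (negPf wv) eq_sym (negPf xw).
  by move/disj/disjointFr/(_ ve); rewrite !inE eqxx.
move=> w M _ /andP[-> eM] /=.
by apply/bigcupP; exists [set v; w] => //; rewrite !inE eqxx.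
Qed.

Lemma matching_sum0 t : matching_sum t finset.set0 = 1.
Proof.
rewrite /matching_sum (big_pred1 finset.set0) ?finset.cards0 ?expr0 // => M /=.
apply/idP/eqP => [/and3P[sM _ cM]|->]; last exact: matching_in0.
apply/eqP; rewrite -finset.subset0; apply/fintype.subsetP => e eM.
have /edges_neq0/finset.set0Pn[x xe] := fintype.subsetP sM _ eM.
have : x \in finset.cover M by apply/bigcupP; exists e.
by move/(fintype.subsetP cM); rewrite inE.
Qed.

(** The vertex recurrence determines the sums, and [phi] preserves it, so induction on [#|S|] avoids
    transporting matchings. *)
Lemma matching_sum_aut (phi : {perm V}) t (S : {set V}) : automorphism E phi ->
  matching_sum t [set phi x | x in S] = matching_sum t S.
Proof.
move=> phiE; have [m] := ubnP #|S|; elim: m S => // m IHm S.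
case: (set_0Vmem S) => [->|[v vS]]; first by rewrite imset0.
rewrite (cardsD1 v) vS add1n ltnS => Sm.
have imD (T : {set V}) (x : V) :
    [set phi y | y in T] :\ phi x = [set phi y | y in T :\ x].
  apply/setP => z; rewrite !inE; apply/andP/imsetP => [[zx /imsetP[y yT zE]]|].
    by exists y; rewrite // !inE yT andbT; apply: contraNneq zx => <-; apply/eqP.
  by case=> y; rewrite !inE => /andP[yx yT] ->; rewrite imset_f // (inj_eq perm_inj).
rewrite (@matching_sum_rec t (phi v)) ?imset_f// (matching_sum_rec _ vS).
rewrite imD IHm //; congr (_ + _ * _).
rewrite (reindex_inj (@perm_inj _ phi)) /=.
apply: eq_big => [w|w _].
  by rewrite phiE mem_imset //; apply: perm_inj.
rewrite imD IHm //; apply: leq_ltn_trans Sm.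
by rewrite subset_leq_card // finset.subsetDl.
Qed.

Lemma card_matching_le (S : {set V}) (M : {set {set V}}) :
  matching_in S M -> (2 * #|M| <= #|S|)%N.
Proof.
by case/and3P => sM tM cM; rewrite -card_cover_matching // subset_leq_card.
Qed.

Lemma sum_num_matchings (Z : nmodType) (f : nat -> Z) :
  \sum_(0 <= k < #|V|./2.+1) f k *+ num_matchings E k
    = \sum_(M | matching_in [set: V] M) f #|M|.
Proof.
(* The cast [inord] does not alter the size, since a matching has at most [#|V|./2] edges. *)
rewrite (partition_big (fun M : {set {set V}} => inord #|M| : 'I_(#|V|./2.+1))
  predT) //= big_mkord; apply: eq_bigr => k _.
have cardM M : matching_in [set: V] M -> (inord #|M| == k) = (#|M| == k :> nat).
  move/card_matching_le; rewrite finset.cardsT => leM.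
  by rewrite -val_eqE /= inordK // ltnS -(doubleK #|M|) half_leq // -mul2n.
rewrite (eq_bigl (mem [set M : {set {set V}} | is_matching E k M])); last first.
  move=> M; rewrite !inE /is_matching andbA -matching_in_setT.
  by case: (boolP (matching_in _ M)) => // /cardM ->.
rewrite (eq_bigr (fun=> f k)) ?sumr_const //.
by move=> M; rewrite !inE => /and3P[_ _ /eqP ->].
Qed.

(** Double counting of the pairs of a matching and a vertex that it leaves uncovered. *)
Lemma sum_matching_sumD1 t :
  \sum_v matching_sum t ([set: V] :\ v)
    = \sum_(M | matching_in [set: V] M) t ^+ #|M| *+ (#|V| - 2 * #|M|).
Proof.
rewrite (exchange_big_dep (fun M => matching_in [set: V] M)) /=; last first.
  by move=> v M _; rewrite matching_inD1 ?inE // => /andP[].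
apply: eq_bigr => M mM.
rewrite (eq_bigl (mem (~: finset.cover M))); last first.
  by move=> v; rewrite matching_inD1 ?inE // mM.
rewrite sumr_const; congr (_ *+ _).
move: mM; rewrite matching_in_setT => /andP[sM tM].
by rewrite -card_cover_matching // -(cardsC (finset.cover M)) addKn.
Qed.

End MatchingSums.

(** * Real-rootedness of the matching generating polynomial *)

Section RealRootedness.
Set Implicit Arguments.
Unset Strict Implicit.
Variables (V : finType) (E : rel V) (R : realType).
Hypothesis simpleE : simple_graph E.
Local Notation C := R[i].

Lemma Re_inv_gt0 (z : C) : 0 < complex.Re z -> 0 < complex.Re z^-1.
Proof.
case: z => a b /= a0; apply: divr_gt0 => //.
by rewrite ltr_pwDl ?exprn_gt0 ?sqr_ge0.
Qed.

Lemma Re_gt0_neq0 (z : C) : 0 < complex.Re z -> z != 0.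
Proof. by apply: contraTneq => ->; rewrite ltxx. Qed.

Lemma Re_sum (I : Type) (r : seq I) (P : pred I) (F : I -> C) :
  complex.Re (\sum_(i <- r | P i) F i) = \sum_(i <- r | P i) complex.Re (F i).
Proof. by rewrite raddf_sum. Qed.

(* The right half-plane is stable under addition and inversion, hence under
   [r v = (s^-1 + \sum_w r w)^-1], the recurrence for the ratios
   [r v = s * matching_sum (s ^+ 2) (S :\ v) / matching_sum (s ^+ 2) S]. *)
Lemma matching_sum_half_plane (s : C) (S : {set V}) : 0 < complex.Re s ->
  matching_sum E (s ^+ 2) S != 0 /\
  forall v, v \in S -> 0 < complex.Re (s * matching_sum E (s ^+ 2) (S :\ v)
                                         / matching_sum E (s ^+ 2) S).
Proof.
move=> s_gt0; have [m] := ubnP #|S|; elim: m S => // m IHm S Sm.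
have s0 := Re_gt0_neq0 s_gt0.
have ratio v : v \in S ->
    matching_sum E (s ^+ 2) S != 0 /\
    0 < complex.Re (s * matching_sum E (s ^+ 2) (S :\ v) / matching_sum E (s ^+ 2) S).
  move=> vS; move: Sm; rewrite (cardsD1 v) vS add1n ltnS => /IHm[Z0 Zr].
  pose D := s^-1 + \sum_(w | E v w && (w \in S))
    s * matching_sum E (s ^+ 2) (S :\ v :\ w) / matching_sum E (s ^+ 2) (S :\ v).
  have D_gt0 : 0 < complex.Re D.
    rewrite raddfD /= ltr_pwDl ?Re_inv_gt0 // Re_sum sumr_ge0 // => w /andP[Evw wS].
    by apply/ltW/Zr; rewrite !inE wS andbT eq_sym (edge_neq simpleE).
  have ZS : matching_sum E (s ^+ 2) S = s * matching_sum E (s ^+ 2) (S :\ v) * D.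
    rewrite (matching_sum_rec simpleE _ vS) /D -mulr_suml -mulr_sumr.
    by field; rewrite s0 Z0.
  have D0 := Re_gt0_neq0 D_gt0.
  rewrite ZS !mulf_neq0 //; split=> //.
  by rewrite (_ : _ / _ = D^-1) ?Re_inv_gt0 //; field; rewrite s0 Z0 D0.
split=> [|v /ratio[]//].
case: (set_0Vmem S) => [->|[v /ratio[]//]].
by rewrite matching_sum0 // oner_neq0.
Qed.

(** Write [z] as [s ^+ 2]. Unless [s] is purely imaginary, [s] or [- s] lies in the right
    half-plane, where the sum does not vanish; and the square of an imaginary number is real. *)
Lemma matching_sum_roots_real (z : C) :
  matching_sum E z [set: V] = 0 -> complex.Im z = 0.
Proof.
have sqrE : z = sqrtc z ^+ 2 by rewrite sqr_sqrtc.
move: (sqrtc z) sqrE => s -> Z0.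
have : complex.Re s = 0.
  case: (ltrgt0P (complex.Re s)) => // Re_s.
    by have [/eqP] := matching_sum_half_plane [set: V] Re_s.
  have : 0 < complex.Re (- s) by rewrite raddfN /= oppr_gt0.
  by case/(matching_sum_half_plane [set: V]); rewrite sqrrN Z0 eqxx.
by rewrite expr2; case: s {Z0} => a b /= ->; rewrite mul0r mulr0 addr0.
Qed.

Lemma matching_gen_polyE : matching_gen_poly R E = matching_sum E 'X [set: V].
Proof.
rewrite /matching_sum -(sum_num_matchings simpleE (fun k => 'X^k : {poly R})).
by apply: eq_bigr => k _; rewrite scaler_nat.
Qed.

Lemma horner_matching_gen_poly (t : R) :
  (matching_gen_poly R E).[t] = matching_sum E t [set: V].
Proof.
rewrite matching_gen_polyE horner_sum.
by apply: eq_bigr => M _; rewrite hornerXn.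
Qed.

Lemma horner_complex_matching_gen_poly (z : C) :
  (map_poly (real_complex R) (matching_gen_poly R E)).[z]
    = matching_sum E z [set: V].
Proof.
rewrite matching_gen_polyE rmorph_sum horner_sum.
by apply: eq_bigr => M _; rewrite rmorphXn /= map_polyX hornerXn.
Qed.

(** The factorization over the complex numbers only involves real roots, so it descends by
    injectivity of the coefficient embedding. *)
Lemma real_rooted_split (p : {poly R}) :
  (forall z : C, root (map_poly (real_complex R) p) z -> complex.Im z = 0) ->
  {r : seq R | p = lead_coef p *: \prod_(x <- r) ('X - x%:P)}.
Proof.
move=> p_real; have [r rE] := closed_field_poly_normal (map_poly (real_complex R) p).
exists [seq complex.Re z | z <- r].
apply: (map_poly_inj (real_complex R)).
have [p0|p0] := eqVneq p 0; first by rewrite p0 lead_coef0 scale0r.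
rewrite [LHS]rE lead_coef_map map_polyZ /= rmorph_prod /= big_map; congr (_ *: _).
rewrite big_seq [RHS]big_seq; apply: eq_bigr => z zr.
rewrite rmorphB /= map_polyX map_polyC /=; congr (_ - _%:P).
have : complex.Im z = 0.
  apply: p_real; rewrite rE rootZ ?root_prod_XsubC //.
  by rewrite lead_coef_eq0 map_poly_eq0.
by case: z {zr} => a b /= ->.
Qed.

(** The value at 0 is 1, so each root [x] is nonzero and contributes the factor with [g = - x^-1].
    The degree is below [#|V|./2] when no matching has that many edges; zeros then pad the list. *)
Lemma matching_gen_poly_split : exists gs : seq R,
  size gs = #|V|./2 /\ matching_gen_poly R E = \prod_(g <- gs) (1 + g *: 'X).
Proof.
set p := matching_gen_poly R E.
have [z|r rE] := @real_rooted_split p.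
  by rewrite rootE horner_complex_matching_gen_poly => /eqP/matching_sum_roots_real.
have p0 : p.[0] = 1.
  rewrite horner_matching_gen_poly /matching_sum (bigD1 finset.set0) /=; last exact: matching_in0.
  rewrite finset.cards0 expr0 big1 ?addr0 // => M /andP[_ M0].
  by rewrite expr0n finset.cards_eq0 (negPf M0).
have pn0 : p != 0 by apply: contra_eq_neq p0 => ->; rewrite horner0 eq_sym oner_neq0.
have r0 x : x \in r -> x != 0.
  move=> xr; apply: contra_eq_neq p0 => x0.
  have /rootP : root p x by rewrite rE rootZ ?lead_coef_eq0 // root_prod_XsubC.
  by rewrite x0 => ->; rewrite eq_sym oner_neq0.
have prodE : p = \prod_(x <- r) (1 + (- x^-1) *: 'X).
  have XE : \prod_(x <- r) ('X - x%:P)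
      = (\prod_(x <- r) - x) *: \prod_(x <- r) (1 + (- x^-1) *: 'X).
    rewrite -scaler_prod big_seq [RHS]big_seq; apply: eq_bigr => x /r0 x0.
    rewrite scalerDr scalerA mulrNN divff // scale1r addrC.
    by rewrite scaleNr -alg_polyC.
  have q0 : (\prod_(x <- r) (1 + (- x^-1) *: 'X)).[0] = 1.
    by rewrite horner_prod big1 // => x _; rewrite !hornerE.
  (* Evaluation at 0 shows that the leading coefficient times the product of the [- x] is 1. *)
  have := p0; rewrite {1}rE XE !hornerZ q0 mulr1 => c1.
  by rewrite {1}rE XE scalerA c1 scale1r.
have szr : (size r <= #|V|./2)%N.
  rewrite -ltnS -(size_prod_XsubC r id) -(size_scale _ (_ : lead_coef p != 0)).
    rewrite -rE /p /matching_gen_poly big_mkord.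
    apply: leq_trans (size_sum _ _ _) _; apply/bigmax_leqP => k _.
    by rewrite (leq_trans (size_scale_leq _ _)) // size_polyXn.
  by rewrite lead_coef_eq0.
exists ([seq - x^-1 | x <- r] ++ nseq (#|V|./2 - size r) 0); split.
  by rewrite size_cat size_map size_nseq subnKC.
rewrite big_cat big_map -prodE /= big1_seq ?mulr1 // => x /andP[_].
by rewrite mem_nseq => /andP[_ /eqP ->]; rewrite scale0r addr0.
Qed.

End RealRootedness.

(** * Correlation inequalities in bipartite graphs *)

Section Correlations.
Set Implicit Arguments.
Unset Strict Implicit.
Variables (V : finType) (E : rel V) (R : realType).
Hypothesis simpleE : simple_graph E.
Variable t : R.
Hypothesis t_gt0 : 0 < t.
Local Notation Z := (matching_sum E t).

Lemma matching_sum_gt0 (S : {set V}) : 0 < Z S.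
Proof.
rewrite /matching_sum (bigD1 finset.set0) /=; last exact: matching_in0.
rewrite ltr_pwDl ?exprn_gt0 // sumr_ge0 // => M _.
by rewrite exprn_ge0 // ltW.
Qed.

Variable A : {set V}.
Hypothesis bipA : forall u v, E u v -> (u \in A) != (v \in A).

(* In the [else] branch, the first factor on the right is the matching sum of the graph
   without the edge [u v]. *)
Lemma matching_sum_correlation (S : {set V}) u v :
  u \in S -> v \in S -> u != v ->
  if (u \in A) == (v \in A)
  then Z S * Z (S :\ u :\ v) <= Z (S :\ u) * Z (S :\ v)
  else Z (S :\ u) * Z (S :\ v)
         <= (Z S - t * (E u v)%:R * Z (S :\ u :\ v)) * Z (S :\ u :\ v).
Proof.
have [m] := ubnP #|S|; elim: m S u v => // m IHm S u v.
rewrite [#|S|](cardsD1 u) => + uS vS uv; rewrite uS add1n ltnS => Sm.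
have D1C (T : {set V}) x y : T :\ x :\ y = T :\ y :\ x.
  by rewrite !finset.setDDl finset.setUC.
have inD1 x y : x \in S -> x != y -> x \in S :\ y by move=> xS xy; rewrite !inE xy.
have uSv := inD1 u v uS uv; have vSu := inD1 v u vS; rewrite eq_sym uv in vSu.
(* Both this and the next expansion are taken at [u]. Deleting the edge [u v] removes [v] from the
   neighbours of [u], so the two sums run over the same [w]. *)
have ZSuv : Z S - t * (E u v)%:R * Z (S :\ u :\ v) = Z (S :\ u) + t *
    \sum_(w | E u w && (w \in S :\ v)) Z (S :\ u :\ w).
  rewrite (matching_sum_rec simpleE t uS); case: (boolP (E u v)) => Euv.
    rewrite (bigD1 v) ?Euv //= mulrDr mulr1 addrA addrAC addrK.
    by congr (_ + _ * _); apply: eq_bigl => w; rewrite !inE -andbA (andbC (w \in S)).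
  rewrite mulr0 mul0r subr0; congr (_ + _ * _); apply: eq_bigl => w.
  by rewrite !inE; case: eqVneq => // ->; rewrite (negPf Euv).
have ZSvu : Z (S :\ v) = Z (S :\ u :\ v) + t *
    \sum_(w | E u w && (w \in S :\ v)) Z (S :\ u :\ w :\ v).
  rewrite (matching_sum_rec simpleE t uSv) (D1C S v u).
  by congr (_ + _ * _); apply: eq_bigr => w _; rewrite D1C.
(* A neighbour [w] of [u] is on the other side, so the induction hypothesis for [w] and [v] in
   [S :\ u] is the opposite case. The term of a possible edge [w v] is dropped. *)
have IHw w : E u w && (w \in S :\ v) ->
    if (u \in A) == (v \in A)
    then Z (S :\ u :\ w) * Z (S :\ u :\ v) <= Z (S :\ u) * Z (S :\ u :\ w :\ v)
    else Z (S :\ u) * Z (S :\ u :\ w :\ v) <= Z (S :\ u :\ w) * Z (S :\ u :\ v).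
  rewrite !inE => /and3P[Euw wv wS].
  have wu : w != u by rewrite eq_sym (edge_neq simpleE).
  have := IHm _ w v Sm (inD1 w u wS wu) (vSu isT) wv.
  have := bipA Euw; case: (u \in A); case: (w \in A); case: (v \in A) => //= _;
    move=> /le_trans; apply; rewrite ler_pM2r ?matching_sum_gt0 //;
    by rewrite lerBlDr lerDl !mulr_ge0 // ltW // matching_sum_gt0.
case: eqP IHw => [side|_] IHw.
  have Euv : E u v = false.
    by apply/negP => /bipA; rewrite side eqxx.
  move: ZSuv; rewrite Euv mulr0 mul0r subr0 => ->.
  rewrite ZSvu mulrDl mulrDr lerD2l -mulrA [leRHS]mulrCA ler_pM2l //.
  by rewrite [leLHS]mulr_suml [leRHS]mulr_sumr; apply: ler_sum.
rewrite ZSuv ZSvu mulrDl mulrDr lerD2l [leLHS]mulrCA -[leRHS]mulrA ler_pM2l //.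
by rewrite [leLHS]mulr_sumr [leRHS]mulr_suml; apply: ler_sum.
Qed.

Hypothesis transE : vertex_transitive E.

(** Here vertex-transitivity enters: the probability of being uncovered is the same at every
    vertex. *)
Lemma matching_sumD1_transitive u v :
  Z ([set: V] :\ u) = Z ([set: V] :\ v).
Proof.
have [phi [phiE phi_u]] := transE u v.
rewrite -(matching_sum_aut simpleE _ _ phiE); congr (matching_sum _ _ _).
apply/setP => x; rewrite !inE andbT; apply/imsetP/idP => [[y]|xv].
  rewrite !inE andbT => yu ->; apply: contraNneq yu => yv.
  by apply/eqP/(@perm_inj _ phi); rewrite phi_u.
exists ((phi^-1)%g x); rewrite ?permKV // !inE andbT.
by apply: contraNneq xv => xu; rewrite -[x](permKV phi) xu phi_u.
Qed.

Variable d : nat.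
Hypothesis d_ge2 : (2 <= d)%N.
Hypothesis regE : regular E d.

(* With [p e] the probability that the edge [e] is in the random matching and [f]
   the probability that a vertex is uncovered, the correlation inequality says
   [t * f ^+ 2 <= p e * (1 - p e)], while the [d] edges at a vertex satisfy
   [\sum_e p e = 1 - f]; Cauchy-Schwarz gives
   [d ^+ 2 * t * f ^+ 2 <= (1 - f) * (d - 1 + f) <= d - 1]. *)
Lemma uncovered_bound v :
  d%:R ^+ 2 * t * (Z ([set: V] :\ v) / Z [set: V]) ^+ 2 <= d%:R - 1.
Proof.
pose z := Z [set: V]; have z_gt0 : 0 < z := matching_sum_gt0 _.
pose f := Z ([set: V] :\ v) / z; rewrite -/z -/f.
have f_gt0 : 0 < f by rewrite divr_gt0 ?matching_sum_gt0.
pose p w := t * Z ([set: V] :\ v :\ w) / z.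
have sum_p : \sum_(w | E v w) p w = 1 - f.
  rewrite /p -mulr_suml -mulr_sumr /f -[1](divff (lt0r_neq0 z_gt0)) -mulrBl.
  congr (_ / _); rewrite /z (matching_sum_rec simpleE t (_ : v \in [set: V])) ?inE //.
  rewrite addrAC subrr add0r; congr (_ * _).
  by apply: eq_bigl => w; rewrite inE andbT.
have p_bound w : E v w -> t * f ^+ 2 <= p w * (1 - p w).
  move=> Evw; have := @matching_sum_correlation [set: V] v w; rewrite !inE.
  move=> /(_ isT isT (edge_neq simpleE Evw)); rewrite (negPf (bipA Evw)) Evw mulr1.
  rewrite (matching_sumD1_transitive w v) -/z.
  have -> : Z ([set: V] :\ v) = f * z by rewrite /f mulfVK // gt_eqF.
  have pE : t * Z ([set: V] :\ v :\ w) = p w * z by rewrite /p mulfVK // gt_eqF.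
  (* The extra factor [t] turns the sum without both ends into [p w * z]. *)
  rewrite -(ler_pM2l t_gt0) [leRHS]mulrCA pE.
  have -> : t * (f * z * (f * z)) = t * f ^+ 2 * z ^+ 2 by ring.
  have -> : (z - p w * z) * (p w * z) = p w * (1 - p w) * z ^+ 2 by ring.
  by rewrite ler_pM2r ?exprn_gt0.
have card_nb : \sum_(w | E v w) (1 : R) = d%:R.
  rewrite sumr_const -(regE v); congr (_%:R); apply: eq_card => w.
  by rewrite !inE.
have d_gt0 : 0 < d%:R :> R by rewrite ltr0n; lia.
pose c := (1 - f) / d%:R.
(* Cauchy-Schwarz in tangent form: [x * (1 - x)] is concave and lies below its tangent at the mean
   [c] of the [p w], with gap [(p w - c) ^+ 2]. The factor [1] prepares the summation by
   [card_nb]. *)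
have tangent w : E v w -> t * f ^+ 2 <= (1 - 2 * c) * p w + c ^+ 2 * 1.
  move=> /p_bound /le_trans; apply; rewrite -subr_ge0.
  by rewrite (_ : _ - _ = (p w - c) ^+ 2) ?sqr_ge0 //; ring.
have := @ler_sum R V (index_enum V) (E v) (fun=> t * f ^+ 2 * 1) _
  (fun w Ew => ltac:(rewrite mulr1; exact: tangent w Ew)).
rewrite big_split /= -!mulr_sumr sum_p card_nb.
have cE : 1 - f = c * d%:R by rewrite /c mulfVK // gt_eqF.
rewrite cE => H.
have {}H : t * f ^+ 2 * d%:R <= c * (1 - c) * d%:R by apply: le_trans H _; lra.
rewrite (_ : d%:R ^+ 2 * t * f ^+ 2 = d%:R * (t * f ^+ 2 * d%:R)); last by ring.
have dge2 : 2 <= d%:R :> R by rewrite ler_nat.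
apply: le_trans (_ : d%:R * (c * (1 - c) * d%:R) <= _); first by rewrite ler_pM2l.
have -> : d%:R * (c * (1 - c) * d%:R) = (1 - f) * (d%:R - (1 - f)) by rewrite cE; ring.
(* The left side equals [d%:R - 1 - f * (d%:R - 2) - f ^+ 2]. *)
nra.
Qed.

End Correlations.

(** * Counting small gammas *)

Section GammaBound.
Set Implicit Arguments.
Unset Strict Implicit.
Variables (V : finType) (E : rel V) (R : realType).
Hypothesis simpleE : simple_graph E.
Variables (n : nat) (gs : seq R).
Hypothesis cardV : #|V| = (2 * n)%N.
Hypothesis size_gs : size gs = n.
Hypothesis gsE : matching_gen_poly R E = \prod_(g <- gs) (1 + g *: 'X).

Lemma horner_prod_gs t : \prod_(g <- gs) (1 + g * t) = matching_sum E t [set: V].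
Proof.
rewrite -(horner_matching_gen_poly simpleE) gsE horner_prod.
by apply: eq_bigr => g _; rewrite !hornerE.
Qed.

Lemma factor_neq0 t g : 0 < t -> g \in gs -> 1 + g * t != 0.
Proof.
move=> t_gt0 g_gs; apply/negP => /eqP g0.
have := matching_sum_gt0 E t_gt0 [set: V].
by rewrite -horner_prod_gs (big_rem g) //= g0 mul0r ltxx.
Qed.

(** A negative [g] would make its factor vanish at the positive point [- g^-1], where the product is
    a positive matching sum. *)
Lemma gamma_ge0 g : g \in gs -> 0 <= g.
Proof.
move=> g_gs; rewrite leNgt; apply/negP => g_lt0.
have t_gt0 : 0 < - g^-1 by rewrite oppr_gt0 invr_lt0.
by have /eqP := factor_neq0 t_gt0 g_gs; rewrite mulrN divff ?lt_eqF // subrr.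
Qed.

(** The logarithmic derivative of the product, multiplied out. *)
Lemma horner_deriv_prod (r : seq R) t : (forall g, g \in r -> 1 + g * t != 0) ->
  (\prod_(g <- r) (1 + g *: 'X))^`().[t]
    = \prod_(g <- r) (1 + g * t) * \sum_(g <- r) g / (1 + g * t).
Proof.
elim: r => [|g r IHr] r0; first by rewrite !big_nil derivC horner0 mulr0.
rewrite !big_cons derivM hornerD !hornerM IHr; last first.
  by move=> h hr; apply: r0; rewrite inE hr orbT.
have g0 : 1 + g * t != 0 by apply: r0; rewrite inE eqxx.
rewrite (_ : (\prod_(j <- r) _).[t] = \prod_(j <- r) (1 + j * t)); last first.
  by rewrite horner_prod; apply: eq_bigr => j _; rewrite !hornerE.
rewrite !poly.derivE add0r !hornerE /=.
by field.
Qed.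

Lemma horner_deriv_matching_gen_poly t : t * (matching_gen_poly R E)^`().[t]
  = \sum_(M : {set {set V}} | matching_in E [set: V] M) t ^+ #|M| *+ #|M|.
Proof.
rewrite (matching_gen_polyE R simpleE) raddf_sum horner_sum mulr_sumr.
apply: eq_bigr => M _; rewrite /= derivXn hornerMn hornerXn mulrnAr.
by case: #|M| => [|k]; rewrite ?mulr0n // exprS.
Qed.

Hypothesis transE : vertex_transitive E.

(** The mean number of uncovered vertices, halved. By transitivity it is the left side; as [n] minus
    the mean size of a matching, given by the logarithmic derivative, it is the right side. *)
Lemma uncovered_sum v t : 0 < t ->
  n%:R * (matching_sum E t ([set: V] :\ v) / matching_sum E t [set: V])
    = \sum_(g <- gs) (1 + g * t)^-1.
Proof.
move=> t_gt0; have z_gt0 := matching_sum_gt0 E t_gt0 [set: V].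
have := sum_matching_sumD1 simpleE t.
rewrite (eq_bigr (fun=> matching_sum E t ([set: V] :\ v))); last first.
  by move=> u _; exact: matching_sumD1_transitive.
rewrite sumr_const cardV.
rewrite [RHS](eq_bigr (fun M : {set {set V}} =>
  (2 * n)%:R * t ^+ #|M| - 2 * (t ^+ #|M| *+ #|M|))); last first.
  move=> M /(card_matching_le simpleE); rewrite finset.cardsT cardV => leM.
  by rewrite mulrnBr // !mulr_natl -mulrnA (mulnC #|M|).
rewrite sumrB -mulr_sumr -mulr_sumr -horner_deriv_matching_gen_poly.
rewrite gsE horner_deriv_prod; last by move=> g; exact: factor_neq0.
rewrite horner_prod_gs -/(matching_sum E t [set: V]) => sumE.
have -> : \sum_(g <- gs) (1 + g * t)^-1
    = n%:R - t * \sum_(g <- gs) g / (1 + g * t).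
  rewrite mulr_sumr -size_gs -sum1_size natr_sum -sumrB.
  rewrite big_seq [RHS]big_seq; apply: eq_bigr => g /(factor_neq0 t_gt0) g0.
  by field.
move: sumE; rewrite -mulr_natl natrM => sumE.
apply: (mulIf (lt0r_neq0 z_gt0)); rewrite mulrA mulfVK ?gt_eqF //.
by lra.
Qed.

Variables (A : {set V}) (d : nat).
Hypothesis bipA : forall u v, E u v -> (u \in A) != (v \in A).
Hypothesis d_ge2 : (2 <= d)%N.
Hypothesis regE : regular E d.

(* For [t > 0] the [k] factors with [g <= c] give [k / (1 + c t) <= n f], where
   [f <= sqrt (d - 1) / (d sqrt t)]; the best choice is [t = c^-1]. *)
Lemma count_gamma_bound c : 0 <= c ->
  d%:R ^+ 2 * (count (fun g => g <= c) gs)%:R ^+ 2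
    <= 4 * (d%:R - 1) * n%:R ^+ 2 * c.
Proof.
move=> c_ge0; set k := count _ _.
have [k0|k_gt0] := posnP k.
  rewrite k0 expr0n mulr0 !mulr_ge0 ?sqr_ge0 // subr_ge0 ler1n; lia.
have /card_gt0P[v _] : (0 < #|V|)%N.
  by rewrite cardV muln_gt0 /= -size_gs; apply: leq_trans k_gt0 (count_size _ _).
have main t : 0 < t ->
    d%:R ^+ 2 * t * k%:R ^+ 2 <= (d%:R - 1) * n%:R ^+ 2 * (1 + c * t) ^+ 2.
  move=> t_gt0.
  have := uncovered_bound simpleE t_gt0 bipA transE d_ge2 regE v.
  have := uncovered_sum v t_gt0.
  set f := _ / _ => fE f_bound.
  have ct_gt0 : 0 < 1 + c * t by rewrite ltr_pwDl // mulr_ge0 // ltW.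
  (* Only the terms with [g <= c] are kept, each at least [(1 + c * t)^-1]; the others are
     nonnegative. *)
  have kf : k%:R <= n%:R * f * (1 + c * t).
    rewrite -ler_pdivrMr // fE /k -sum1_count natr_sum mulr_suml.
    rewrite [leRHS](bigID (fun g => g <= c)) /= ler_wpDr //.
      rewrite big_seq_cond sumr_ge0 // => g /andP[/gamma_ge0 g_ge0 _].
      by rewrite invr_ge0 addr_ge0 // mulr_ge0 // ltW.
    rewrite big_seq_cond [leRHS]big_seq_cond; apply: ler_sum => g.
    move=> /andP[/gamma_ge0 g_ge0 gc]; rewrite mul1r lef_pV2 ?posrE //.
      by rewrite lerD2l ler_wpM2r // ltW.
    by rewrite ltr_pwDl // mulr_ge0 // ltW.
  apply: le_trans (_ : d%:R ^+ 2 * t * (n%:R * f * (1 + c * t)) ^+ 2 <= _).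
    apply: ler_wpM2l; first by rewrite mulr_ge0 ?sqr_ge0 // ltW.
    by rewrite lerXn2r ?nnegrE //; apply: le_trans kf.
  have -> : d%:R ^+ 2 * t * (n%:R * f * (1 + c * t)) ^+ 2
    = d%:R ^+ 2 * t * f ^+ 2 * (n%:R * (1 + c * t)) ^+ 2 by ring.
  by rewrite -[leRHS]mulrA -exprMn ler_wpM2r ?sqr_ge0.
have k2_gt0 : 0 < d%:R ^+ 2 * k%:R ^+ 2 :> R.
  by rewrite mulr_gt0 ?exprn_gt0 ?ltr0n //; lia.
have [c0|c_neq0] := eqVneq c 0.
  pose b : R := (d%:R - 1) * n%:R ^+ 2.
  have b_ge0 : 0 <= b by rewrite mulr_ge0 ?sqr_ge0 // subr_ge0 ler1n; lia.
  have b1_gt0 : 0 < b + 1 by rewrite ltr_wpDl.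
  have := main _ (divr_gt0 b1_gt0 k2_gt0).
  by rewrite c0 mul0r addr0 expr1n mulr1 -/b mulrAC mulrC mulfVK ?gt_eqF //; lra.
have c_gt0 : 0 < c by rewrite lt_def c_neq0.
have := main c^-1; rewrite invr_gt0 => /(_ c_gt0).
rewrite divff // mulrAC ler_pdivrMr //; lra.
Qed.

End GammaBound.

(** * The zeros of the matching polynomial *)

Section MatchingMeasure.
Set Implicit Arguments.
Unset Strict Implicit.
Variable R : realType.

Lemma size_prod_1addZX (r : seq R) :
  (size (\prod_(g <- r) (1 + g *: 'X))%R <= (size r).+1)%N.
Proof.
elim: r => [|g r IHr]; first by rewrite big_nil size_poly1.
rewrite big_cons; apply: leq_trans (size_polyMleq _ _) _ => /=.
have : (size (1 + g *: 'X : {poly R})%R <= 2)%N.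
  rewrite (leq_trans (size_polyD _ _)) // size_poly1 geq_max /=.
  by rewrite (leq_trans (size_scale_leq _ _)) // size_polyX.
by move=> size_factor; rewrite -subn1; apply: (leq_sub2r 1 (leq_add size_factor IHr)).
Qed.

(** Reversal of coefficients with alternating signs; [Y = 'X^2] turns the generating polynomial into
    the matching polynomial. *)
Lemma prod_1addZX_reverse (r : seq R) (Y : {poly R}) :
  \sum_(k < (size r).+1)
      ((-1) ^+ k * (\prod_(g <- r) (1 + g *: 'X))`_k) *: Y ^+ (size r - k)
    = \prod_(g <- r) (Y - g%:P).
Proof.
elim: r => [|g r IHr].
  by rewrite !big_nil big_ord1 expr0 mul1r coefC scale1r.
rewrite !big_cons -IHr; set q := \prod_(_ <- r) _; set m := size r.
have coefE k : ((1 + g *: 'X) * q)`_k = q`_k + g * (if k == 0%N then 0 else q`_k.-1).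
  by rewrite mulrDl mul1r coefD -scalerAl coefZ coefXM.
under eq_bigr => k _ do rewrite coefE mulrDr scalerDl.
rewrite big_split /= mulrBl; congr (_ + _).
  rewrite big_ord_recr /= (_ : q`_m.+1 = 0); last first.
    by rewrite nth_default // size_prod_1addZX.
  rewrite mulr0 scale0r addr0 mulr_sumr; apply: eq_bigr => k _.
  by rewrite subSn -1?ltnS // exprS scalerAr.
rewrite big_ord_recl /= !mulr0 scale0r add0r mulr_sumr -sumrN.
apply: eq_bigr => k _; rewrite /bump /= add1n subSS exprS mul_polyC scalerA -scaleNr.
by congr (_ *: _); ring.
Qed.

Variables (V : finType) (E : rel V).
Hypothesis simpleE : simple_graph E.
Variables (n : nat) (gs : seq R).
Hypothesis cardV : #|V| = (2 * n)%N.
Hypothesis size_gs : size gs = n.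
Hypothesis gsE : matching_gen_poly R E = \prod_(g <- gs) (1 + g *: 'X).

Lemma half_cardV : #|V|./2 = n.
Proof. by rewrite cardV mul2n doubleK. Qed.

Lemma coef_matching_gen_poly k : (k < n.+1)%N ->
  (matching_gen_poly R E)`_k = (num_matchings E k)%:R.
Proof.
move=> kn; rewrite /matching_gen_poly half_cardV big_mkord.
by rewrite -(poly_def _ (fun k => (num_matchings E k)%:R)) coef_poly kn.
Qed.

Lemma matching_poly_factor :
  matching_poly R E = \prod_(g <- gs) ('X^2 - g%:P).
Proof.
rewrite -prod_1addZX_reverse -gsE size_gs /matching_poly half_cardV big_mkord.
apply: eq_bigr => k _; rewrite coef_matching_gen_poly //.
by rewrite -exprM mulnBr cardV -mul2n.
Qed.

Definition signed_sqrts : seq R :=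
  [seq Num.sqrt g | g <- gs] ++ [seq - Num.sqrt g | g <- gs].

Lemma matching_poly_split :
  matching_poly R E = \prod_(z <- signed_sqrts) ('X - z%:P).
Proof.
rewrite matching_poly_factor /signed_sqrts big_cat !big_map /= -big_split /=.
rewrite big_seq [RHS]big_seq; apply: eq_bigr => g g_gs.
rewrite polyCN opprK -subr_sqr -polyC_exp sqr_sqrtr //.
by rewrite (gamma_ge0 simpleE gsE).
Qed.

(** Each [z] occurs in both lists as often as its multiplicity in the split polynomial; [rootsR] has
    no repetition, so only one block contributes. *)
Lemma perm_matching_zeros : perm_eq (matching_zeros R E) signed_sqrts.
Proof.
apply/allP => z _ /=; apply/eqP.
rewrite -[RHS]mu_prod_XsubC -matching_poly_split.
set p := matching_poly R E.
have p0 : p != 0.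
  by rewrite /p matching_poly_split monic_neq0 // monic_prod_XsubC.
rewrite /matching_zeros -/p count_flatten -map_comp.
have count_nseq_mup x : count_mem z (nseq (mup x p) x) = (if x == z then mup z p else 0)%N.
  by rewrite count_nseq /=; case: eqP => [->|_]; rewrite ?mul1n ?mul0n.
rewrite (eq_map (g := fun x => if x == z then mup z p else 0%N)) //.
have uniqR : uniq (rootsR p) by rewrite /rootsR uniq_roots.
rewrite sumnE big_map -big_mkcond /= big_const_seq iter_addn_0.
rewrite (_ : count _ _ = count_mem z (rootsR p)); last by apply: eq_count => x /=.
rewrite count_uniq_mem //.
have := roots_on_rootsR p0 z; rewrite inE /= => <-.
case: (boolP (root p z)) => [_|/mupNroot ->]; by rewrite ?muln1 ?mul0n.
Qed.

Lemma matching_measure_itv s :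
  matching_measure R E `[(- s)%R, s]%classic
    = (#|V|%:R^-1 * (count (fun z => - s <= z <= s) signed_sqrts)%:R)%:E.
Proof.
rewrite -(seq.permP perm_matching_zeros) /matching_measure /mscale /msum /=.
rewrite EFinM; congr (_ * _)%E.
rewrite -sum1_count natr_sum -sumEFin (big_nth 0) big_mkord [RHS]big_mkcond /=.
apply: eq_bigr => i _; apply: etrans (diracE _ _ _) _.
rewrite (_ : (_ \in _) = (- s <= (matching_zeros R E)`_i <= s)).
  by case: ifP.
by apply/idP/idP; rewrite inE /= in_itv.
Qed.

End MatchingMeasure.

Theorem theorem1p9 (R : realType) (V : finType) (E : rel V) (d n : nat) :
  (2 <= d)%N ->
  simple_graph E -> vertex_transitive E -> bipartite E -> regular E d ->
  #|V| = (2 * n)%N ->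
  [/\ exists gamma : nat -> R, is_gamma E n gamma,
      forall gamma : nat -> R, is_gamma E n gamma ->
        forall k : nat, (1 <= k <= n)%N ->
          gamma k >= (d%:R ^+ 2 / (4 * (d%:R - 1))) * (k%:R ^+ 2 / n%:R ^+ 2)
    & forall s : R, 0 < s ->
        (matching_measure R E `[(- s)%R, s]%classic
           <= (2 * Num.sqrt (d%:R - 1) / d%:R * s)%:E)%E].
Proof.
move=> d_ge2 simpleE transE [A bipA] regE cardV.
have halfV := half_cardV cardV.
have d1_gt0 : 0 < d%:R - 1 :> R by rewrite subr_gt0 ltr1n.
have d_gt0 : 0 < d%:R :> R by rewrite ltr0n; lia.
have [gs [size_gs gsE]] := matching_gen_poly_split R simpleE.
rewrite halfV in size_gs; split.
(* The predecessor reconciles indexing from 1 with list positions from 0. *)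
- exists (fun k => nth 0 (sort <=%R gs) k.-1); split=> [i j i1 ij jn|].
    by apply: sorted_leq_nth; rewrite ?inE ?size_sort ?size_gs ?sort_le_sorted //;
       [exact: le_trans | lia..].
  rewrite gsE -(perm_big _ (permEl (perm_sort <=%R gs))) big_add1 /= (big_nth 0).
  by rewrite size_sort size_gs.
- move=> gamma [gamma_le gammaE] k /andP[k1 kn].
  pose hs := [seq gamma j | j <- iota 1 n].
  have size_hs : size hs = n by rewrite size_map size_iota.
  have hsE : matching_gen_poly R E = \prod_(g <- hs) (1 + g *: 'X).
    by rewrite gammaE /hs big_map /index_iota subn1.
  have gk : gamma k \in hs by apply: map_f; rewrite mem_iota; lia.
  have := count_gamma_bound simpleE cardV size_hs hsE transE bipA d_ge2 regE
    (gamma_ge0 simpleE hsE gk).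
  (* By monotonicity the first [k] values are all at most [gamma k], the threshold used in the
     count. *)
  have count_ge : (k <= count (fun g => (g <= gamma k)%R) hs)%N.
    have : all (fun j => (gamma j <= gamma k)%R) (iota 1 k).
      by apply/allP => j; rewrite mem_iota => ?; apply: gamma_le; lia.
    rewrite all_count size_iota => /eqP count_k.
    rewrite count_map -(subnKC kn) iotaD count_cat -{1}count_k.
    exact: leq_addr.
  move=> bound; have n_gt0 : 0 < n%:R :> R by rewrite ltr0n; lia.
  rewrite mulf_div ler_pdivrMr ?mulr_gt0 ?exprn_gt0 // mulrC [leRHS]mulrC.
  rewrite mulrC; apply: le_trans bound.
  by rewrite ler_wpM2l ?sqr_ge0 // lerXn2r ?nnegrE ?ler0n // ler_nat.
- move=> s s_gt0.
  rewrite (matching_measure_itv simpleE cardV size_gs gsE) lee_fin cardV.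
  (* On the empty graph the measure is scaled by [0^-1 = 0]. *)
  have [->|n_gt0] := posnP n.
    by rewrite muln0 invr0 mul0r !mulr_ge0 ?sqrtr_ge0 ?invr_ge0 // ltW.
  have := count_gamma_bound simpleE cardV size_gs gsE transE bipA d_ge2 regE
    (sqr_ge0 s).
  set K := count _ gs => bound.
  (* For negative [g] the root defaults to 0, but the conclusion is trivial. *)
  have le_sqr g : Num.sqrt g <= s -> g <= s ^+ 2.
    have [g_ge0 gs_le|g_lt0 _] := lerP 0 g; last by rewrite (le_trans (ltW g_lt0)) ?sqr_ge0.
    by rewrite -(sqr_sqrtr g_ge0) lerXn2r ?nnegrE ?sqrtr_ge0 // ltW.
  (* Each [g <= s ^+ 2] accounts for at most two zeros in the interval, and no other [g] for any. *)
  have count_le : (count (fun z => (- s <= z <= s)%R) (signed_sqrts gs) <= 2 * K)%N.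
    rewrite count_cat !count_map mul2n -addnn leq_add //; apply: sub_count => g /=.
      by case/andP => _ /le_sqr.
    by rewrite lerN2 => /andP[/le_sqr].
  have nR : 0 < n%:R :> R by rewrite ltr0n.
  (* This is the square root of the counting bound at [c = s ^+ 2]. *)
  have dK : d%:R * K%:R <= 2 * n%:R * Num.sqrt (d%:R - 1) * s.
    rewrite -(@ler_pXn2r _ 2) ?nnegrE ?mulr_ge0 ?sqrtr_ge0 ?(ltW s_gt0) //.
    rewrite exprMn; apply: le_trans bound _.
    by rewrite 3!exprMn sqr_sqrtr ?(ltW d1_gt0) //; lra.
  rewrite mulrC ler_pdivrMr ?ltr0n ?muln_gt0 //.
  apply: le_trans (_ : (2 * K)%:R <= _); first by rewrite ler_nat.
  rewrite -(ler_pM2l d_gt0) !natrM.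
  have -> : d%:R * (2 * Num.sqrt (d%:R - 1) / d%:R * s * (2 * n%:R))
     = 2 * (2 * n%:R * Num.sqrt (d%:R - 1) * s) :> R by field; rewrite gt_eqF.
  by rewrite mulrCA ler_pM2l.
Qed.
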